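(* Let $G$ be a graph. Then $\chi_{lt}(G)=3$ if and only if $G$ is (isomorphic to) one of the following graphs: $P_3$; $P_6$; $mC_6$ for some integer $m\ge 1$; or $mC_6+P_6$ for some integer $m\ge 0$.
   Context: All graphs are finite, simple and loopless, of order $p=|V|\ge 3$ and size $q=|E|\ge 2$, with no isolated vertex and no $K_2$ component (graphs may be disconnected). A local total antimagic labeling of $G=(V,E)$ is a bijection $f:V\cup E\to\{1,\dots,p+q\}$ such that, with weights $w_f(u)=\sum f(e)$ over all edges $e$ incident to $u$ for $u\in V$ (the label of $u$ itself is not included) and $w_f(uv)=f(u)+f(v)$ for $uv\in E$, one has: adjacent vertices have distinct weights, adjacent edges have distinct weights, and every vertex has a weight distinct from that of each of its incident edges. $\chi_{lt}(G)$ is the minimum, over all local total antimagic labelings $f$ of $G$, of the number of distinct values among all the vertex and edge weights. $G+H$ is the disjoint union of $G$ and $H$, $mG$ is the disjoint union of $m$ copies of $G$ (so $0C_6+P_6=P_6$), $P_n$ is the path on $n$ vertices and $C_n$ is the cycle on $n$ vertices. *)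

(* Defs.v *)
From HB Require Import structures.
From mathcomp Require Import all_boot.

Set Implicit Arguments.
Unset Strict Implicit.
Unset Printing Implicit Defensive.

Record graph := Graph {
  vertex :> finType;
  adj : rel vertex;
  adj_sym : symmetric adj;
  adj_irrefl : irreflexive adj }.

Definition edges (G : graph) : {set {set G}} :=
  [set [set z.1; z.2] | z in [set z : G * G | adj z.1 z.2]].

Definition edge (G : graph) : finType := {e : {set G} | e \in edges G}.

Definition gorder (G : graph) : nat := #|vertex G|.
Definition gsize (G : graph) : nat := #|edges G|.

Definition isomorphic (G H : graph) : Prop :=
  exists2 h : G -> H, bijective h & forall x y, adj (h x) (h y) = adj x y.

Section Induced.
Variables (G : graph) (S : {set G}).
Definition ind_adj : rel {x : G | x \in S} := fun x y => adj (val x) (val y).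
Lemma ind_adj_sym : symmetric ind_adj.
Proof. by move=> x y; apply: adj_sym. Qed.
Lemma ind_adj_irrefl : irreflexive ind_adj.
Proof. by move=> x; apply: adj_irrefl. Qed.
Definition induced : graph := Graph ind_adj_sym ind_adj_irrefl.
End Induced.

Definition component (G : graph) (x : G) : {set G} :=
  [set y | connect (@adj G) x y].

Section Complete.
Variable n : nat.
Definition K_adj : rel 'I_n := fun i j => i != j.
Lemma K_adj_sym : symmetric K_adj.
Proof. by move=> i j; rewrite /K_adj eq_sym. Qed.
Lemma K_adj_irrefl : irreflexive K_adj.
Proof. by move=> i; rewrite /K_adj eqxx. Qed.
Definition complete : graph := Graph K_adj_sym K_adj_irrefl.
End Complete.

Section Path.
Variable n : nat.
Definition P_adj : rel 'I_n :=
  fun i j => (i.+1 == j :> nat) || (j.+1 == i :> nat).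
Lemma P_adj_sym : symmetric P_adj.
Proof. by move=> i j; rewrite /P_adj orbC. Qed.
Lemma P_adj_irrefl : irreflexive P_adj.
Proof. by move=> i; rewrite /P_adj gtn_eqF. Qed.
Definition path_graph : graph := Graph P_adj_sym P_adj_irrefl.
End Path.

(* The cycle C_n for n >= 3; the conjunct i != j only matters when n = 1. *)
Section Cycle.
Variable n : nat.
Definition C_adj : rel 'I_n :=
  fun i j => (i != j) && ((ordS i == j) || (ordS j == i)).
Lemma C_adj_sym : symmetric C_adj.
Proof. by move=> i j; rewrite /C_adj eq_sym orbC. Qed.
Lemma C_adj_irrefl : irreflexive C_adj.
Proof. by move=> i; rewrite /C_adj eqxx. Qed.
Definition cycle_graph : graph := Graph C_adj_sym C_adj_irrefl.
End Cycle.

Section DisjointUnion.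
Variables G H : graph.
Definition union_adj : rel (G + H)%type := fun x y =>
  match x, y with
  | inl a, inl b => adj a b
  | inr a, inr b => adj a b
  | _, _ => false
  end.
Lemma union_adj_sym : symmetric union_adj.
Proof. by case=> x [] y //=; apply: adj_sym. Qed.
Lemma union_adj_irrefl : irreflexive union_adj.
Proof. by case=> x /=; apply: adj_irrefl. Qed.
Definition disjoint_union : graph := Graph union_adj_sym union_adj_irrefl.
End DisjointUnion.

Section Copies.
Variables (m : nat) (G : graph).
Definition copies_adj : rel ('I_m * G)%type :=
  fun x y => (x.1 == y.1) && adj x.2 y.2.
Lemma copies_adj_sym : symmetric copies_adj.
Proof. by move=> x y; rewrite /copies_adj eq_sym adj_sym. Qed.
Lemma copies_adj_irrefl : irreflexive copies_adj.
Proof. by move=> x; rewrite /copies_adj adj_irrefl andbF. Qed.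
Definition copies : graph := Graph copies_adj_sym copies_adj_irrefl.
End Copies.

Section Labeling.
Variables (G : graph) (f : G + edge G -> nat).

Definition total_labeling : Prop :=
  injective f /\
  forall k, (1 <= k <= gorder G + gsize G) <-> (exists x, f x = k).

Definition vweight (u : G) : nat := \sum_(e : edge G | u \in val e) f (inr e).
Definition eweight (e : edge G) : nat := \sum_(u in val e) f (inl u).

Definition weight (x : G + edge G) : nat :=
  match x with inl u => vweight u | inr e => eweight e end.

Definition local_total_antimagic : Prop :=
  [/\ total_labeling,
      forall u v : G, adj u v -> vweight u <> vweight v,
      forall e e' : edge G, e != e' -> val e :&: val e' != set0 ->
        eweight e <> eweight e'
    & forall (u : G) (e : edge G), u \in val e -> vweight u <> eweight e].

Definition num_weights : nat := size (undup [seq weight x | x : G + edge G]).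
End Labeling.

(* Relational form of chi_lt(G) = k; it holds for no k if G has no local total
   antimagic labeling. *)
Definition chi_lt (G : graph) (k : nat) : Prop :=
  (exists2 f : G + edge G -> nat,
     local_total_antimagic f & num_weights f = k) /\
  (forall f : G + edge G -> nat, local_total_antimagic f -> k <= num_weights f).

(* Main.v *)
Require Import Defs.
From HB Require Import structures.
From mathcomp Require Import all_boot.
From mathcomp Require Import zify.

(* A vertex, an incident edge and its other end have distinct weights, so three
   weights are needed, and if only three occur we order them cyclically and orient
   each edge uv from u to v when w(v) is the weight following w(u). Then every
   vertex has at most one successor and at most one predecessor, and the edge uv
   has the third weight. Writing l(u) for the label of u and m(u) for that of the
   edge leaving u (0 if none), we get m(u) + m(su) = w(su) and
   l(u) + l(su) = w(ssu). Iterating the first relation from a vertex without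
   predecessor, m vanishes at the end of a P_3 or of a P_6 and nowhere else; the
   second one gives l(s^6 u) = l(u), so all other components are 6-cycles, because
   a triangle would force l(u) = m(su). At most one path occurs, and it stands
   alone if it is a P_3. Joining the ends of a P_6 by an edge with label 0 turns
   mC_6 + P_6 into (m+1)C_6, so one explicit family of labels serves both. *)

Set Implicit Arguments.
Unset Strict Implicit.
Unset Printing Implicit Defensive.

(** * Isomorphisms, bijections and unordered pairs *)

Lemma isomorphic_sym (G H : graph) : isomorphic G H -> isomorphic H G.
Proof.
case=> h [g hK gK] hadj; exists g; first by exists h.
by move=> x y; rewrite -hadj !gK.
Qed.

Lemma isomorphic_trans (G H K : graph) :
  isomorphic G H -> isomorphic H K -> isomorphic G K.
Proof.
case=> h bij_h hadj [g bij_g gadj]; exists (g \o h); first exact: bij_comp.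
by move=> x y; rewrite /= gadj hadj.
Qed.

Lemma inj_surj_bij (S T : finType) (h : S -> T) :
  injective h -> (forall y, exists x, h x = y) -> bijective h.
Proof.
move=> inj_h /fin_all_exists[g gK]; exists g => // x.
exact/inj_h/gK.
Qed.

Lemma set2_inj (T : finType) (x y x' y' : T) :
  [set x; y] = [set x'; y'] -> x = x' /\ y = y' \/ x = y' /\ y = x'.
Proof.
move=> e.
have: x \in [set x'; y'] by rewrite -e set21.
have: y \in [set x'; y'] by rewrite -e set22.
have: x' \in [set x; y] by rewrite e set21.
have: y' \in [set x; y] by rewrite e set22.
rewrite !inE => /orP[]/eqP h1 /orP[]/eqP h2 /orP[]/eqP h3 /orP[]/eqP h4.
all: by subst; auto.
Qed.

(** * Edge labels and vertex weights *)

Section Edges.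
Variable G : graph.
Implicit Types (u v : G) (e : edge G).

Lemma adj_neq u v : adj u v -> u != v.
Proof. by apply: contraTneq => ->; rewrite adj_irrefl. Qed.

Lemma edge_ends e : exists u v, adj u v /\ val e = [set u; v].
Proof. by case: e => e /= /imsetP[[u v]]; rewrite inE; exists u, v. Qed.

Lemma adj_edge u v : adj u v -> exists e, val e = [set u; v].
Proof.
move=> uv; have he : [set u; v] \in edges G.
  by apply/imsetP; exists (u, v); rewrite ?inE.
by exists (Sub [set u; v] he : edge G); rewrite SubK.
Qed.

Lemma edge_adj e u v : val e = [set u; v] -> adj u v.
Proof.
have [x [y [xy ->]]] := edge_ends e.
by case/set2_inj=> -[<- <-] //; rewrite adj_sym.
Qed.

Lemma eweightE (f : G + edge G -> nat) e u v :
  val e = [set u; v] -> eweight f e = f (inl u) + f (inl v).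
Proof.
move=> eE; have uv := adj_neq (edge_adj eE).
by rewrite /eweight eE big_setU1 ?inE //= big_set1.
Qed.

(** The sum has at most one term, since an edge is determined by its ends. The value 0 at
    non-adjacent pairs lets a vertex weight be written as a sum over all vertices. *)
Definition edge_label (f : G + edge G -> nat) u v : nat :=
  \sum_(e | val e == [set u; v]) f (inr e).

Variable f : G + edge G -> nat.

Lemma edge_label_sym u v : edge_label f u v = edge_label f v u.
Proof. by rewrite /edge_label setUC. Qed.

Lemma edge_labelE e u v : val e = [set u; v] -> edge_label f u v = f (inr e).
Proof.
by move=> eE; rewrite /edge_label -eE (big_pred1 e).
Qed.

Lemma edge_label0 u v : ~~ adj u v -> edge_label f u v = 0.
Proof.
by move=> uv; rewrite /edge_label big1 // => e /eqP/edge_adj; rewrite (negPf uv).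
Qed.

Lemma vweightE u : vweight f u = \sum_v edge_label f u v.
Proof.
rewrite /edge_label /vweight.
(* After the exchange, an edge at [u] is counted for exactly one [v], its other end. *)
rewrite (exchange_big_dep (fun e : edge G => u \in val e)) /=; last first.
  by move=> v e _ /eqP->; rewrite set21.
apply: eq_bigr => e ue.
have [x [y [xy eE]]] := edge_ends e.
wlog xu : x y xy eE / x = u => [IH|].
  have: u \in [set x; y] by rewrite -eE.
  rewrite !inE => /orP[]/eqP uE; first exact: (IH x y).
  by apply: (IH y x); rewrite // ?(adj_sym y) // setUC.
rewrite (big_pred1 y) // => v /=; rewrite eE xu; apply/eqP/eqP=> [|->//].
by case/set2_inj=> -[h1 h2]; rewrite h2 // -h1.
Qed.

End Edges.

(** * At least three weights occur *)

Section LowerBound.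
Variables (G : graph) (f : G + edge G -> nat).
Hypothesis lta : local_total_antimagic f.

Lemma weights_neq (u v : G) (e : edge G) : val e = [set u; v] ->
  uniq [:: vweight f u; eweight f e; vweight f v].
Proof.
move=> eE; have [_ vv _ ve] := lta; have uv := edge_adj eE.
rewrite /= !inE !negb_or !andbT -andbA; apply/and3P; split; apply/eqP.
- by apply: ve; rewrite eE set21.
- exact: vv.
by apply/nesym/ve; rewrite eE set22.
Qed.

Lemma num_weights_ge3 (u v : G) : adj u v -> 3 <= num_weights f.
Proof.
case/adj_edge=> e /weights_neq w3; apply: (uniq_leq_size w3) => x.
have wP y : weight f y \in undup [seq weight f y | y : G + edge G].
  by rewrite mem_undup; apply/mapP; exists y; rewrite ?mem_enum.
rewrite !inE => /or3P[]/eqP->.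
- exact: (wP (inl u)).
- exact: (wP (inr e)).
exact: (wP (inl v)).
Qed.

End LowerBound.

(** * Labelings built from a successor map *)

(* [lam u] is the label of the edge from [u] to [s u], or 0 when that edge is
   missing. *)
Section SuccessorLabeling.
Variables (G : graph) (s : G -> G) (lab lam w w' : G -> nat) (N a b c : nat).
Hypotheses (s_inj : injective s)
  (s2 : forall u, s (s u) != u)
  (adjE : forall u v, adj u v =
     (0 < lam u) && (s u == v) || (0 < lam v) && (s v == u))
  (lab_inj : injective lab) (lam_inj : injective lam)
  (lab_lam : forall u v, lab u != lam v)
  (lab_bounds : forall u, 0 < lab u <= N) (lam_le : forall u, lam u <= N)
  (lab_lam_onto : forall k, 0 < k <= N -> exists u, lab u = k \/ lam u = k)
  (lam_sum : forall u, lam u + lam (s u) = w (s u))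
  (lab_sum : forall u, 0 < lam u -> lab u + lab (s u) = w' u)
  (w_proper : forall u, [&& w u != w' u, w u != w (s u), w' u != w (s u)
                          & w' u != w' (s u)])
  (w_mem : forall u, w u \in [:: a; b; c]) (w'_mem : forall u, w' u \in [:: a; b; c]).

(** The sum has a single term, the start of the edge: by [s2] no edge is traversed in both
    directions. *)
Definition succ_labeling (x : G + edge G) : nat :=
  match x with
  | inl u => lab u
  | inr e => \sum_(u | val e == [set u; s u]) lam u
  end.

Lemma succ_edge (e : edge G) :
  exists2 u, 0 < lam u & val e = [set u; s u].
Proof.
have [u [v [+ ->]]] := edge_ends e; rewrite adjE.
case/orP=> /andP[lam0 /eqP<-]; first by exists u.
by exists v; rewrite // setUC.
Qed.

Lemma succ_set2_inj (u v : G) : [set u; s u] = [set v; s v] -> u = v.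
Proof.
case/set2_inj=> -[] // uE vE.
by have := s2 v; rewrite -uE vE eqxx.
Qed.

Lemma succ_labelingE (e : edge G) u :
  val e = [set u; s u] -> succ_labeling (inr e) = lam u.
Proof.
move=> eE; rewrite /= (big_pred1 u) // => v; rewrite eE.
by apply/eqP/eqP=> [/succ_set2_inj|->].
Qed.

Lemma succ_edge_label u : edge_label succ_labeling u (s u) = lam u.
Proof.
have [lam0|] := posnP (lam u).
  rewrite edge_label0 // adjE lam0 /=.
  by rewrite (negPf (s2 u)) andbF.
move=> lam0; have /adj_edge[e eE] : adj u (s u) by rewrite adjE lam0 eqxx.
by rewrite (edge_labelE _ eE) (succ_labelingE eE).
Qed.

Lemma succ_onto v : exists u, s u = v.
Proof. by exists (invF s_inj v); rewrite f_invF. Qed.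

Lemma succ_vweight v : vweight succ_labeling v = w v.
Proof.
(* The only possible neighbours of [s u] are [u] and [s (s u)]. A missing edge contributes
   [lam = 0], so the ends of a path need no separate case. *)
have [u <-] := succ_onto v; rewrite -lam_sum vweightE.
rewrite (bigD1 u) //= (bigD1 (s (s u))) ?s2 //=.
rewrite edge_label_sym !succ_edge_label big1 ?addn0 // => x /andP[xu xs].
apply: edge_label0; rewrite adjE negb_or !negb_and (eq_sym _ x) xs orbT /=.
by rewrite (inj_eq s_inj) xu orbT.
Qed.

Lemma succ_eweight (e : edge G) u :
  0 < lam u -> val e = [set u; s u] -> eweight succ_labeling e = w' u.
Proof. by move=> lam0 eE; rewrite (eweightE _ eE) /= lab_sum. Qed.

Lemma succ_labeling_inj : injective succ_labeling.
Proof.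
case=> [u|e] [v|e'].
- by move/lab_inj->.
- have [v _ vE] := succ_edge e'; rewrite (succ_labelingE vE) => /eqP.
  by rewrite (negPf (lab_lam u v)).
- have [u _ uE] := succ_edge e; rewrite (succ_labelingE uE) => /esym/eqP.
  by rewrite (negPf (lab_lam v u)).
have [u _ uE] := succ_edge e; have [v _ vE] := succ_edge e'.
rewrite (succ_labelingE vE) (succ_labelingE uE) => /lam_inj uv.
by congr inr; apply: val_inj; rewrite uE vE uv.
Qed.

Lemma succ_labeling_range k :
  0 < k <= N <-> exists x, succ_labeling x = k.
Proof.
split=> [kN|[[u|e] <-]]; last 2 first.
- exact: lab_bounds.
- by have [u lam0 uE] := succ_edge e; rewrite (succ_labelingE uE) lam0 lam_le.
have [u [<-|uk]] := lab_lam_onto kN; first by exists (inl u).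
have /adj_edge[e eE] : adj u (s u) by rewrite adjE uk eqxx; case/andP: kN => ->.
by exists (inr e); rewrite (succ_labelingE eE).
Qed.

(** That [N] equals p + q follows by counting, since the labeling is injective with range 1 to
    [N]. *)
Lemma succ_labeling_total : total_labeling succ_labeling.
Proof.
split; first exact: succ_labeling_inj.
suff -> : gorder G + gsize G = N by exact: succ_labeling_range.
transitivity #|{: G + edge G}|; first by rewrite card_sum card_sig.
rewrite cardT -(size_map succ_labeling) -[RHS](size_iota 1).
apply/perm_size/uniq_perm; rewrite ?iota_uniq //.
  by rewrite map_inj_uniq ?enum_uniq //; apply: succ_labeling_inj.
move=> k; rewrite mem_iota add1n ltnS; apply/mapP/idP => [[x _ kE]|].
  by apply/succ_labeling_range; exists x.
by case/succ_labeling_range=> x <-; exists x; rewrite ?mem_enum.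
Qed.

Lemma succ_local_total_antimagic : local_total_antimagic succ_labeling.
Proof.
split=> [|u v|e e' ee' /set0Pn[x]|u e ue].
- exact: succ_labeling_total.
- rewrite adjE !succ_vweight => /orP[]/andP[_ /eqP<-].
    by have /and4P[_ /eqP] := w_proper u.
  by have /and4P[_ /eqP/nesym] := w_proper v.
- have [u lamu uE] := succ_edge e; have [v lamv vE] := succ_edge e'.
  rewrite (succ_eweight lamu uE) (succ_eweight lamv vE) uE vE !inE.
  have uv : u != v.
    by apply: contraNneq ee' => uv; apply/eqP/val_inj; rewrite uE vE uv.
  (* Distinct edges have distinct starts and distinct ends, so a common vertex is the end of one and
     the start of the other. *)
  case/andP=> /orP[]/eqP-> /orP[]; rewrite ?(inj_eq s_inj) ?(negPf uv) //.
    by move=> /eqP->; have /and4P[_ _ _ /eqP/nesym] := w_proper v.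
  by move=> /eqP<-; have /and4P[_ _ _ /eqP] := w_proper u.
have [v lamv vE] := succ_edge e.
rewrite succ_vweight (succ_eweight lamv vE); move: ue; rewrite vE !inE.
have /and4P[/eqP h1 _ /eqP h2 _] := w_proper v.
case/orP=> /eqP->; [exact: h1 | exact: nesym h2].
Qed.

Lemma chi_lt_succ (u v : G) : adj u v -> chi_lt G 3.
Proof.
move=> uv; split=> [|f /num_weights_ge3]; last by apply; exact: uv.
exists succ_labeling; first exact: succ_local_total_antimagic.
apply/eqP; rewrite eqn_leq (num_weights_ge3 succ_local_total_antimagic uv) andbT.
apply: (@uniq_leq_size _ _ [:: a; b; c]) => [|k]; first exact: undup_uniq.
rewrite mem_undup => /mapP[[x|e] _ ->] /=; first by rewrite succ_vweight.
by have [x lam0 xE] := succ_edge e; rewrite (succ_eweight lam0 xE).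
Qed.

End SuccessorLabeling.

(** * Disjoint hexagons, one of them possibly opened *)

Section Hexagons.
Variables (n : nat) (b : bool).
Implicit Types x y : 'I_n * 'I_6.

Definition hex_next x := (x.1, ordS x.2).
Definition hex_edge x := [|| b, 0 < x.1 | x.2 < 5].
Definition hex_adj x y :=
  hex_edge x && (hex_next x == y) || hex_edge y && (hex_next y == x).

Lemma hex_adj_sym : symmetric hex_adj.
Proof. by move=> x y; rewrite /hex_adj orbC. Qed.

Lemma ordS6_neq (i : 'I_6) : ordS i != i.
Proof. by case: i => [[|[|[|[|[|[|//]]]]]] ?]. Qed.

Lemma hex_adj_irrefl : irreflexive hex_adj.
Proof.
move=> x; rewrite /hex_adj orbb; apply/negP=> /andP[_ /eqP/(congr1 snd)/eqP].
by rewrite (negPf (ordS6_neq _)).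
Qed.

(* If [b = false], the edge from 5 to 0 of cycle 0 is missing: that component
   is a P_6. *)
Definition hexagons : graph := Graph hex_adj_sym hex_adj_irrefl.

Lemma hex_next_inj : injective hex_next.
Proof.
move=> [c i] [d j] [-> ij]; congr (_, _); apply: val_inj => /=.
have := ltn_ord i; have := ltn_ord j; lia.
Qed.

End Hexagons.

Lemma C6_adjE (i j : 'I_6) : C_adj i j = (ordS i == j) || (ordS j == i).
Proof.
by rewrite /C_adj; have [->|//] := eqVneq i j; rewrite (negPf (ordS6_neq _)).
Qed.

Lemma hexagons_cycles n : isomorphic (hexagons n true) (copies n (cycle_graph 6)).
Proof.
exists id; first by exists id.
move=> [c i] [d j]; rewrite /= /copies_adj /= C6_adjE /hex_adj /hex_edge /= !xpair_eqE.
by rewrite (eq_sym d); case: (c == d).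
Qed.

Lemma hexagons_cycles_path m :
  isomorphic (hexagons m.+1 false)
    (disjoint_union (copies m (cycle_graph 6)) (path_graph 6)).
Proof.
apply: isomorphic_sym.
(* The opened hexagon has index 0; the closed ones are shifted to 1, ..., [m]. *)
pose h (x : 'I_m * 'I_6 + 'I_6) : 'I_m.+1 * 'I_6 :=
  match x with inl (c, i) => (lift ord0 c, i) | inr i => (ord0, i) end.
pose g (x : 'I_m.+1 * 'I_6) : 'I_m * 'I_6 + 'I_6 :=
  if unlift ord0 x.1 is Some c then inl (c, x.2) else inr x.2.
exists h.
  exists g; first by case=> [[c i]|i]; rewrite /g /= ?liftK ?unlift_none.
  by case=> c i; rewrite /g; case: unliftP => [d|] /= ->.
case=> [[c i]|i] [[d j]|j] /=; rewrite /hex_adj /hex_edge /= ?xpair_eqE.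
- rewrite /copies_adj /= C6_adjE !(inj_eq lift_inj) (eq_sym d).
  by case: (c == d).
- by rewrite !andbF.
- by rewrite !andbF.
by case: i j => [[|[|[|[|[|[|//]]]]]] ?] [[|[|[|[|[|[|//]]]]]] ?].
Qed.

Lemma hexagons_path : isomorphic (hexagons 1 false) (path_graph 6).
Proof.
exists snd.
  by exists (pair ord0) => [[c i]|//]; rewrite [c]ord1.
move=> [c i] [d j]; rewrite [c]ord1 [d]ord1 /=.
by case: i j => [[|[|[|[|[|[|//]]]]]] ?] [[|[|[|[|[|[|//]]]]]] ?].
Qed.

(** * Explicit labels for the hexagons *)

(* With M = 12n, the cyclic sequence x, M-1-x, x+1, M-3-x, x+2, M-2-x has
   consecutive sums M-1, M, M-2, M-1, M, M-2.  Cycle c uses it for its edges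
   with x = 6c and for its vertices with x = 6c+3, and everything is shifted by
   [b], so that the removed edge carries the label 0 when [b = false]. *)
Section HexagonLabels.
Variables (n : nat) (b : bool).
Hypothesis n_gt0 : 0 < n.
Let M := 12 * n.
Implicit Types x y : 'I_n * 'I_6.

(** The sequence starts at position 4 for vertices and at position 5 for edges. With this offset the
    weight of an edge is the one missing at its two ends. *)
Definition hex_vertex_label x : nat :=
  let c := 6 * x.1 in
  b + nth 0 [:: c + 4; M - 6 - c; c + 5; M - 5 - c; c + 3; M - 4 - c] x.2.
Definition hex_edge_label x : nat :=
  let c := 6 * x.1 in
  b + nth 0 [:: M - 1 - c; c + 1; M - 3 - c; c + 2; M - 2 - c; c] x.2.
Definition hex_vertex_weight x : nat :=
  2 * b + nth 0 [:: M - 1; M; M - 2; M - 1; M; M - 2] x.2.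
Definition hex_edge_weight x : nat :=
  2 * b + nth 0 [:: M - 2; M - 1; M; M - 2; M - 1; M] x.2.

Lemma hex_edge_label_gt0 x : (0 < hex_edge_label x) = hex_edge b x.
Proof.
rewrite /hex_edge_label /hex_edge /M; case: x => [[c cn]].
case=> [[|[|[|[|[|[|//]]]]]] ?] /=; case: b; lia.
Qed.

Lemma hex_vertex_label_inj : injective hex_vertex_label.
Proof.
move=> [c i] [d j]; rewrite /hex_vertex_label /M /= => e.
have cn := ltn_ord c; have dn := ltn_ord d.
suff [cd ij] : c = d :> nat /\ i = j :> nat by congr (_, _); apply: val_inj.
move: e; case: i j => [[|[|[|[|[|[|//]]]]]] ?] [[|[|[|[|[|[|//]]]]]] ?] /=; lia.
Qed.

Lemma hex_edge_label_inj : injective hex_edge_label.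
Proof.
move=> [c i] [d j]; rewrite /hex_edge_label /M /= => e.
have cn := ltn_ord c; have dn := ltn_ord d.
suff [cd ij] : c = d :> nat /\ i = j :> nat by congr (_, _); apply: val_inj.
move: e; case: i j => [[|[|[|[|[|[|//]]]]]] ?] [[|[|[|[|[|[|//]]]]]] ?] /=; lia.
Qed.

Lemma hex_labels_disjoint x y : hex_vertex_label x != hex_edge_label y.
Proof.
case: x y => [c i] [d j]; rewrite /hex_edge_label /hex_vertex_label /M /=.
have cn := ltn_ord c; have dn := ltn_ord d.
by case: i j => [[|[|[|[|[|[|//]]]]]] ?] [[|[|[|[|[|[|//]]]]]] ?] /=; lia.
Qed.

Lemma hex_labels_bounds x :
  0 < hex_vertex_label x <= M + b - 1 /\ hex_edge_label x <= M + b - 1.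
Proof.
case: x => [c i]; rewrite /hex_edge_label /hex_vertex_label /M /=.
have cn := ltn_ord c.
by case: i => [[|[|[|[|[|[|//]]]]]] ?] /=; lia.
Qed.

Lemma hex_labels_onto k : 0 < k <= M + b - 1 ->
  exists x, hex_vertex_label x = k \/ hex_edge_label x = k.
Proof.
move=> kM; rewrite /hex_edge_label /hex_vertex_label.
(* The upper half of the labels mirrors the lower half [b + r]. In each half the quotient of [r] by
   6 is the cycle, and the remainder selects one of its vertices or edges. *)
have [r r_lt kE] : exists2 r, r < 6 * n & k = b + r \/ k = b + (12 * n - 1 - r).
  have := leq_b1 b; rewrite /M in kM *; case: (ltnP (k - b) (6 * n)) => kn.
    by exists (k - b); [|left]; lia.
  by exists (12 * n - 1 - (k - b)); [|right]; lia.
have rn : r %/ 6 < n by lia.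
have rE := divn_eq r 6; have r6 : r %% 6 < 6 by rewrite ltn_mod.
have c6 : nat_of_ord (Ordinal rn) = r %/ 6 by [].
rewrite -c6 in rE; move: (Ordinal rn) rE => c rE; have cn := ltn_ord c.
case: kE => kE.
  move: (r %% 6) r6 rE => [|[|[|[|[|[|//]]]]]] _ rE.
  - by exists (c, inord 5); right; rewrite /= inordK //=; lia.
  - by exists (c, inord 1); right; rewrite /= inordK //=; lia.
  - by exists (c, inord 3); right; rewrite /= inordK //=; lia.
  - by exists (c, inord 4); left; rewrite /= inordK //=; lia.
  - by exists (c, inord 0); left; rewrite /= inordK //=; lia.
  - by exists (c, inord 2); left; rewrite /= inordK //=; lia.
rewrite /M; move: (r %% 6) r6 rE => [|[|[|[|[|[|//]]]]]] _ rE.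
- by exists (c, inord 0); right; rewrite /= inordK //=; lia.
- by exists (c, inord 4); right; rewrite /= inordK //=; lia.
- by exists (c, inord 2); right; rewrite /= inordK //=; lia.
- by exists (c, inord 5); left; rewrite /= inordK //=; lia.
- by exists (c, inord 3); left; rewrite /= inordK //=; lia.
- by exists (c, inord 1); left; rewrite /= inordK //=; lia.
Qed.

Lemma hex_edge_label_sum x :
  hex_edge_label x + hex_edge_label (hex_next x) = hex_vertex_weight (hex_next x).
Proof.
case: x => [c i]; rewrite /hex_edge_label /hex_vertex_weight /M /=.
have cn := ltn_ord c.
by case: i => [[|[|[|[|[|[|//]]]]]] ?] /=; lia.
Qed.

Lemma hex_vertex_label_sum x :
  hex_vertex_label x + hex_vertex_label (hex_next x) = hex_edge_weight x.
Proof.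
case: x => [c i]; rewrite /hex_vertex_label /hex_edge_weight /M /=.
have cn := ltn_ord c.
by case: i => [[|[|[|[|[|[|//]]]]]] ?] /=; lia.
Qed.

Lemma hex_weights_proper x :
  [&& hex_vertex_weight x != hex_edge_weight x,
      hex_vertex_weight x != hex_vertex_weight (hex_next x),
      hex_edge_weight x != hex_vertex_weight (hex_next x)
    & hex_edge_weight x != hex_edge_weight (hex_next x)].
Proof.
case: x => [c i]; rewrite /hex_edge_weight /hex_vertex_weight /M /=.
by case: i => [[|[|[|[|[|[|//]]]]]] ?] /=; lia.
Qed.

Lemma hex_weights_mem x : let W := [:: 2 * b + (M - 1); 2 * b + M; 2 * b + (M - 2)] in
  hex_vertex_weight x \in W /\ hex_edge_weight x \in W.
Proof.
case: x => [c i]; rewrite /hex_edge_weight /hex_vertex_weight /= !inE.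
by case: i => [[|[|[|[|[|[|//]]]]]] ?] /=; rewrite !eqxx ?orbT.
Qed.

Lemma chi_lt_hexagons (G : graph) : isomorphic G (hexagons n b) -> chi_lt G 3.
Proof.
case=> h [g hK gK] hadj.
pose x0 : 'I_n * 'I_6 := (Ordinal n_gt0, ord0).
have x01 : adj (g x0) (g (hex_next x0)).
  by rewrite -hadj !gK /= /hex_adj eqxx /hex_edge orbT.
have h_inj := can_inj hK.
pose s u := g (hex_next (h u)).
have hs u : h (s u) = hex_next (h u) by rewrite gK.
(* [M + b - 1] is the number of vertices and edges: [12 * n], or one less when an edge is
   removed. *)
apply: (@chi_lt_succ G s (hex_vertex_label \o h) (hex_edge_label \o h)
  (hex_vertex_weight \o h) (hex_edge_weight \o h) (M + b - 1)
  (2 * b + (M - 1)) (2 * b + M) (2 * b + (M - 2)) _ _ _ _ _ _ _ _ _ _ _ _ _ _ _ _ x01).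
- by move=> u v /(congr1 h); rewrite !hs => /(@hex_next_inj n)/h_inj.
- move=> u; rewrite -(inj_eq h_inj) !hs; case: (h u) => c i.
  by rewrite xpair_eqE eqxx; case: i => [[|[|[|[|[|[|//]]]]]] ?].
- by move=> u v; rewrite -hadj /= !hex_edge_label_gt0 -!(inj_eq h_inj) !hs.
- exact/inj_comp/h_inj/hex_vertex_label_inj.
- exact/inj_comp/h_inj/hex_edge_label_inj.
- by move=> u v; apply: hex_labels_disjoint.
- by move=> u; case: (hex_labels_bounds (h u)).
- by move=> u; case: (hex_labels_bounds (h u)).
- by move=> k /hex_labels_onto[x xk]; exists (g x); rewrite /= gK.
- by move=> u; rewrite /= hs hex_edge_label_sum.
- by move=> u _; rewrite /= hs hex_vertex_label_sum.
- by move=> u; rewrite /= hs hex_weights_proper.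
- by move=> u; case: (hex_weights_mem (h u)).
- by move=> u; case: (hex_weights_mem (h u)).
Qed.

End HexagonLabels.

(** * Explicit labels for P_3 *)

Lemma chi_lt_path3 (G : graph) : isomorphic G (path_graph 3) -> chi_lt G 3.
Proof.
case=> h [g hK gK] hadj.
pose o k : 'I_3 := inord k.
have h01 : adj (g (o 0)) (g (o 1)).
  by rewrite -hadj !gK /= /P_adj !inordK.
have h_inj := can_inj hK.
pose s u := g (ordS (h u)).
have hs u : h (s u) = ordS (h u) by rewrite gK.
(* The successor closes the path to a triangle whose missing edge has label 0. No label sum is
   required on that edge; the last entry 9 of [w'] only keeps the weights properly distributed. *)
pose lab (i : 'I_3) := nth 0 [:: 2; 3; 1] i.
pose lam (i : 'I_3) := nth 0 [:: 4; 5; 0] i.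
pose w (i : 'I_3) := nth 0 [:: 4; 9; 5] i.
pose w' (i : 'I_3) := nth 0 [:: 5; 4; 9] i.
apply: (@chi_lt_succ G s (lab \o h) (lam \o h) (w \o h) (w' \o h)
  5 4 5 9 _ _ _ _ _ _ _ _ _ _ _ _ _ _ _ _ h01).
- move=> u v /(congr1 h); rewrite !hs => e; apply: h_inj; apply: val_inj.
  by move: e; case: (h u) (h v) => [[|[|[|//]]] ?] [[|[|[|//]]] ?] /(congr1 val).
- move=> u; rewrite -(inj_eq h_inj) !hs.
  by case: (h u) => [[|[|[|//]]] ?].
- move=> u v; rewrite -hadj /= -!(inj_eq h_inj) !hs.
  by case: (h u) (h v) => [[|[|[|//]]] ?] [[|[|[|//]]] ?].
- apply/inj_comp/h_inj => i j e; apply: val_inj; move: e.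
  by case: i j => [[|[|[|//]]] ?] [[|[|[|//]]] ?].
- apply/inj_comp/h_inj => i j e; apply: val_inj; move: e.
  by case: i j => [[|[|[|//]]] ?] [[|[|[|//]]] ?].
- by move=> u v /=; case: (h u) (h v) => [[|[|[|//]]] ?] [[|[|[|//]]] ?].
- by move=> u /=; case: (h u) => [[|[|[|//]]] ?].
- by move=> u /=; case: (h u) => [[|[|[|//]]] ?].
- move=> [|[|[|[|[|[|//]]]]]] // _.
  + by exists (g (o 2)); left; rewrite /= gK /lab inordK.
  + by exists (g (o 0)); left; rewrite /= gK /lab inordK.
  + by exists (g (o 1)); left; rewrite /= gK /lab inordK.
  + by exists (g (o 0)); right; rewrite /= gK /lam inordK.
  + by exists (g (o 1)); right; rewrite /= gK /lam inordK.
- by move=> u; rewrite /= hs; case: (h u) => [[|[|[|//]]] ?].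
- by move=> u; rewrite /= hs; case: (h u) => [[|[|[|//]]] ?].
- by move=> u; rewrite /= hs; case: (h u) => [[|[|[|//]]] ?].
- by move=> u /=; case: (h u) => [[|[|[|//]]] ?].
- by move=> u /=; case: (h u) => [[|[|[|//]]] ?].
Qed.

(** * Permutations with all orbits of size six *)

Lemma iter_modn (T : Type) (s : T -> T) (p k : nat) (x : T) :
  (forall y, iter p s y = y) -> iter k s x = iter (k %% p) s x.
Proof.
move=> sp; rewrite {1}(divn_eq k p) addnC iterD; congr iter.
by elim: (k %/ p) => //= q IH; rewrite mulSn iterD IH.
Qed.

(** A point is given by its orbit and its distance from a representative of that orbit. Prescribing
    [x0] as origin lets the opened hexagon start at the source of its path. *)
Lemma hexagon_coordinates (V : finType) (s : V -> V) (x0 : V) :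
  (forall x, iter 6 s x = x) ->
  (forall i x, 0 < i < 6 -> iter i s x != x) ->
  exists n (h : 'I_n.+1 * 'I_6 -> V),
    [/\ bijective h, forall x, h (hex_next x) = s (h x) & h (ord0, ord0) = x0].
Proof.
move=> s6 sN.
have s_inj : injective s by apply: (can_inj (g := iter 5 s)) => x; rewrite -iterSr s6.
have sC := fconnect_sym s_inj.
(* [x0] represents its own orbit and comes first; the other orbits are represented by their
   roots. *)
pose rs := x0 :: enum [pred x | (froot s x == x) && ~~ fconnect s x0 x].
have rs_rep x y : x \in rs -> y \in rs -> fconnect s x y -> x = y.
  rewrite !inE !mem_enum !inE => /orP[/eqP->|/andP[/eqP xr x0x]].
    by case/orP=> [/eqP->|/andP[_ /negPf->]].
  case/orP=> [/eqP->|/andP[/eqP yr x0y]]; first by rewrite sC (negPf x0x).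
  by rewrite -(root_connect sC) xr yr => /eqP.
have rs_uniq : uniq rs.
  by rewrite /= enum_uniq mem_enum inE connect0 andbF.
have rs_cover v : exists2 r, r \in rs & fconnect s r v.
  have [x0v|x0v] := boolP (fconnect s x0 v); first by exists x0; rewrite ?mem_head.
  exists (froot s v); last by rewrite sC connect_root.
  rewrite inE mem_enum !inE (root_root sC) eqxx /=; apply/orP; right.
  by apply: contra x0v => /connect_trans->; rewrite // sC connect_root.
pose h (x : 'I_(size (behead rs)).+1 * 'I_6) := iter x.2 s (nth x0 rs x.1).
exists (size (behead rs)), h; split=> //; last first.
  by case=> c i; rewrite /h /= -iterS -iter_modn.
apply: inj_surj_bij => [[c i] [d j]|v]; last first.
  have [r r_in /iter_findex rv] := rs_cover v.
  have ri : index r rs < (size (behead rs)).+1 by rewrite index_mem.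
  have fi : findex s r v %% 6 < 6 by rewrite ltn_mod.
  exists (Ordinal ri, Ordinal fi).
  by rewrite /h /= -[if _ then _ else _]/(index r rs) nth_index // -iter_modn.
rewrite /h /= => e.
have crs : nth x0 rs c \in rs by rewrite mem_nth.
have drs : nth x0 rs d \in rs by rewrite mem_nth.
have /(rs_rep _ _ crs drs)/eqP : fconnect s (nth x0 rs c) (nth x0 rs d).
  apply: (connect_trans (y := iter i s (nth x0 rs c))); first exact: fconnect_iter.
  by rewrite e sC fconnect_iter.
rewrite nth_uniq // => /eqP/ord_inj cd; congr (_, _) => //; apply: val_inj => /=.
rewrite {c crs}cd in e.
wlog ij : i j e / i <= j.
  by move=> IH; case/orP: (leq_total i j) => [/(IH _ _ e)|/(IH _ _ (esym e))].
(* Cancelling [i] steps would make the representative return after [j - i] steps, with 0 < j - i <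
   6. *)
apply/eqP; rewrite eqn_leq ij /= leqNgt; apply/negP=> ij'.
have := sN (j - i) (nth x0 rs d); rewrite subn_gt0 ij' /=.
rewrite (leq_ltn_trans (leq_subr _ _)) // => /(_ isT)/eqP; apply.
have : injective (iter i s) by elim: (i : nat) => //= k IH x y /s_inj/IH.
by apply; rewrite -iterD subnKC.
Qed.

(** * Structure of the successor relation *)

(* [lam u] is the label of the edge from [u] to its successor, or 0 if there is
   none; [nx] cycles through the three weights. *)
Section SuccessorStructure.
Variables (V : finType) (w lab lam : V -> nat) (suc : rel V) (nx : nat -> nat).
Hypotheses (nxK : forall u, nx (nx (nx (w u))) = w u)
  (nx_neq : forall u, nx (w u) != w u)
  (w_cases : forall u v, [\/ w u = w v, w u = nx (w v) | w v = nx (w u)])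
  (w_gt0 : forall u, 0 < w u)
  (suc_w : forall u v, suc u v -> w v = nx (w u))
  (suc_fun : forall u v v', suc u v -> suc u v' -> v = v')
  (suc_inj : forall u u' v, suc u v -> suc u' v -> u = u')
  (lab_sum : forall u v, suc u v -> lab u + lab v = nx (w v))
  (lam_sum : forall u v, suc u v -> lam u + lam v = w v)
  (lam_source : forall u, (forall p, ~~ suc p u) -> lam u = w u)
  (lam_gt0 : forall u, reflect (exists v, suc u v) (0 < lam u))
  (lam_inj : forall u v, 0 < lam u -> lam u = lam v -> u = v)
  (lab_inj : injective lab) (lab_gt0 : forall u, 0 < lab u)
  (lab_lam : forall u v, lab u != lam v).

Let source u := forall p, ~~ suc p u.

Lemma suc_lam_gt0 u v : suc u v -> 0 < lam u.
Proof. by move=> uv; apply/lam_gt0; exists v. Qed.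

(** With weights a, b, c in cyclic order from [u0], the edge labels along the path are forced: a, b
    - a, a - b + c, b - c, c, 0. As the weights differ, only the third can vanish early; this is
    P_3, with a + c = b. *)
Lemma source_path u0 : source u0 ->
  (exists u1 u2, [/\ suc u0 u1, suc u1 u2, lam u2 = 0
                   & w u0 + nx (nx (w u0)) = nx (w u0)]) \/
  (exists u1 u2 u3 u4 u5,
     [/\ suc u0 u1, suc u1 u2, suc u2 u3 & suc u3 u4] /\
     [/\ suc u4 u5, lam u5 = 0 & lam u4 = nx (nx (w u0))]).
Proof.
move=> /lam_source l0; have := nxK u0; have a0 := w_gt0 u0; have ab := nx_neq u0.
set a := w u0 in l0 a0 ab *; set b := nx a in ab *; set c := nx b => ca.
have [u1 s1] : exists v, suc u0 v by apply/lam_gt0; rewrite l0.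
have w1 : w u1 = b by rewrite (suc_w s1).
have l1 := lam_sum s1; rewrite w1 in l1.
have bc : c != b by rewrite /c -w1 nx_neq.
have [u2 s2] : exists v, suc u1 v by apply/lam_gt0; lia.
have w2 : w u2 = c by rewrite (suc_w s2) w1.
have l2 := lam_sum s2; rewrite w2 in l2.
have [z2|/lam_gt0[u3 s3]] := posnP (lam u2).
  by left; exists u1, u2; split=> //; rewrite -/a -/b -/c; lia.
have w3 : w u3 = a by rewrite (suc_w s3) w2.
have l3 := lam_sum s3; rewrite w3 in l3.
have [u4 s4] : exists v, suc u3 v by apply/lam_gt0; lia.
have w4 : w u4 = b by rewrite (suc_w s4) w3.
have l4 := lam_sum s4; rewrite w4 in l4.
have [u5 s5] : exists v, suc u4 v by apply/lam_gt0; lia.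
have w5 : w u5 = c by rewrite (suc_w s5) w4.
have l5 := lam_sum s5; rewrite w5 in l5.
right; exists u1, u2, u3, u4, u5; split=> //; split=> //; last rewrite -/a -/b -/c.
all: lia.
Qed.

(** The last edge is the only one at [t], so its label is the weight of [t]. Both P_3 and P_6 end at
    a distance from [u0] that is 2 modulo 3, which determines this weight. *)
Lemma source_end u0 : source u0 -> exists t' t,
  [/\ suc t' t, ~ source t', lam t = 0, lam t' = nx (nx (w u0)) & nx (w t) = w u0].
Proof.
move=> src; case: (source_path src) => [[u1 [u2 [s1 s2 z e]]]|].
  have w1 := suc_w s1; have w2 := suc_w s2; exists u1, u2; split=> //.
  - by move/(_ u0); rewrite s1.
  - by have := lam_sum s2; rewrite z addn0 w2 w1.
  - by rewrite w2 w1 nxK.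
case=> u1 [u2 [u3 [u4 [u5 [[s1 s2 s3 s4] [s5 z e]]]]]].
exists u4, u5; split=> //; first by move/(_ u3); rewrite s4.
by rewrite (suc_w s5) (suc_w s4) (suc_w s3) (suc_w s2) (suc_w s1) !nxK.
Qed.

(* The end edges of a path are labelled by two of the three weights, so a second
   path would reuse a label. *)
Lemma source_unique u v : source u -> source v -> u = v.
Proof.
suff two x y : source x -> source y -> w x <> nx (w y).
  move=> su sv; case: (w_cases u v) => [e|/two|/two]; [|by case|by case].
  by apply: lam_inj; rewrite !lam_source.
move=> sx sy xy; have [t' [_ [_ nst _ lt _]]] := source_end sx.
apply: nst; have -> // : t' = y; apply/esym/lam_inj; rewrite lam_source //.
by rewrite lt xy nxK.
Qed.

(* Joins the end [t] of the only possible path to its origin [u0]. *)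
Lemma closed_successor (u0 t : V) : (forall u, source u -> u = u0) ->
  (source u0 -> lam t = 0 /\ nx (w t) = w u0) ->
  exists s : V -> V, [/\ injective s,
    forall u v, suc u v = (0 < lam u) && (s u == v),
    forall u, w (s u) = nx (w u)
  & forall u, lam u = 0 -> [/\ source u0, u = t & s u = u0]].
Proof.
(* [g] is the predecessor map with default [t] at a source. If a source exists, [t] has no
   successor, so the default causes no collision, and [s] can be the inverse of [g]. *)
move=> src u0t; pose g v := odflt t [pick u | suc u v].
have gP v : suc (g v) v \/ source v /\ g v = t.
  rewrite /g; case: pickP => [u|no]; [by left | right; split=> // p].
  by rewrite no.
have g_inj : injective g.
  have no_suc v y : source y -> ~ suc t v.
    move=> sy tv; have [z _] := u0t (eq_ind _ source sy _ (src _ sy)).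
    by have := suc_lam_gt0 tv; rewrite z.
  move=> x y e; case: (gP x) (gP y) => [gx|[sx gx]] [gy|[sy gy]].
  - by move: gx; rewrite e => /suc_fun; apply.
  - by case: (no_suc x y); rewrite // -gy -e.
  - by case: (no_suc y x); rewrite // -gx e.
  by rewrite (src x) // (src y).
pose s := invF g_inj.
have sK : cancel s g by apply: f_invF.
have gK : cancel g s by apply: invF_f.
have lam0 u : lam u = 0 -> [/\ source u0, u = t & s u = u0].
  move=> z; have := gP (s u); rewrite sK => -[su|[su ut]].
    by have := suc_lam_gt0 su; rewrite z.
  by split=> //; rewrite -?(src _ su).
exists s; split=> //; first exact: can_inj sK.
  move=> u v; apply/idP/andP => [uv|[lu /eqP<-]].
    split; first exact: suc_lam_gt0 uv.
    case: (gP v) => [/suc_inj/(_ uv)<-|[/(_ u)]]; first by rewrite gK.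
    by rewrite uv.
  case: (gP (s u)); rewrite sK // => -[su ut].
  have uv := src _ su; rewrite uv in su; have [z _] := u0t su.
  by rewrite ut z in lu.
move=> u; have := gP (s u); rewrite sK => -[/suc_w//|[su ut]].
have uv := src _ su; rewrite uv in su *; have [_ <-] := u0t su.
by rewrite {1}ut.
Qed.

Lemma hexagonal_successor (s : V -> V) (u0 t : V) :
  (forall u v, suc u v = (0 < lam u) && (s u == v)) ->
  (forall u, w (s u) = nx (w u)) ->
  (forall u, lam u = 0 -> [/\ source u0, u = t & s u = u0]) ->
  (source u0 -> lab t + lab u0 = nx (w u0)) ->
  (forall u, iter 6 s u = u) /\ (forall i u, 0 < i < 6 -> iter i s u != u).
Proof.
move=> sucE ws lam0 labt.
have labs u : lab u + lab (s u) = nx (w (s u)).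
  have [/lam0[su -> st]|lu] := posnP (lam u); last by rewrite lab_sum // sucE lu /=.
  have [z|lt] := posnP (lam t); last by rewrite lab_sum // sucE lt /=.
  by have [_ _ ->] := lam0 t z; apply: labt.
have lams u : lam u + lam (s u) = w (s u).
  have [z|lu] := posnP (lam u); last by rewrite lam_sum // sucE lu /=.
  by have [su _ ->] := lam0 u z; rewrite z (lam_source su).
(* In the alternating sum of six consecutive label relations the right-hand sides cancel, because
   weights have period 3 along [s]. *)
have s6 u : iter 6 s u = u.
  apply: lab_inj; rewrite /=.
  have := labs u; have := labs (s u); have := labs (s (s u)).
  have := labs (s (s (s u))); have := labs (s (s (s (s u)))).
  have := labs (s (s (s (s (s u))))); rewrite !ws !nxK.
  set v1 := s u; set v2 := s v1; set v3 := s v2; set v4 := s v3.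
  set v5 := s v4; set v6 := s v5; lia.
split=> // i u i6; apply/eqP.
have w1 : nx (w u) <> w u by apply/eqP.
have w2 : nx (nx (w u)) <> w u by move=> /(congr1 nx); rewrite nxK => /esym.
case: i i6 => [|[|[|[|[|[|i]]]]]] // _ /=.
- by move/(congr1 w); rewrite ws.
- by move/(congr1 w); rewrite !ws.
(* On a triangle with weights a, b, c from [u], both [2 * lab u] and [2 * lam (s u)] equal b + c -
   a. *)
- move=> u3; suff : lab u = lam (s u) by apply/eqP.
  have := labs u; have := labs (s u); have := labs (s (s u)).
  have := lams u; have := lams (s u); have := lams (s (s u)).
  by rewrite u3 !ws nxK; lia.
- by move/(congr1 w); rewrite !ws nxK.
- by move/(congr1 w); rewrite !ws nxK.
Qed.

(* Outside the path, the labels of two vertices at distance three on a 6-cycle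
   would add up to 0. *)
Lemma path3_successor (s : V -> V) (u0 u1 u2 : V) : injective s ->
  (forall u v, suc u v = (0 < lam u) && (s u == v)) ->
  (forall u, w (s u) = nx (w u)) ->
  (forall u, lam u = 0 -> u = u2) ->
  s u0 = u1 -> s u1 = u2 -> s u2 = u0 -> w u0 + nx (nx (w u0)) = nx (w u0) ->
  forall v, v \in [:: u0; u1; u2].
Proof.
move=> s_inj sucE ws lam0 su0 su1 su2 e v; apply/negPn/negP=> v_out.
have out_s y : y \notin [:: u0; u1; u2] -> s y \notin [:: u0; u1; u2].
  apply: contraNN; rewrite !inE => /or3P[]/eqP.
  - by rewrite -{1}su2 => /s_inj->; rewrite eqxx !orbT.
  - by rewrite -{1}su0 => /s_inj->; rewrite eqxx.
  by rewrite -{1}su1 => /s_inj->; rewrite eqxx orbT.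
have labs y : y \notin [:: u0; u1; u2] -> lab y + lab (s y) = nx (w (s y)).
  move=> y_out; rewrite lab_sum // sucE eqxx andbT lt0n.
  by apply: contraNneq y_out => /lam0->; rewrite !inE eqxx !orbT.
(* Among three consecutive vertices outside the path, one is a [y] from which the label sums are a,
   b, c in this order, where a is [w u0]; the sum of the two outer labels is then a - b + c = 0. *)
suff [y y_out wy] : exists2 y, y \notin [:: u0; u1; u2] & nx (w (s (s y))) = nx (w u0).
  have := lab_gt0 y; have := lab_gt0 (s (s (s y))).
  have := labs y y_out; have := labs _ (out_s _ y_out).
  have := labs _ (out_s _ (out_s _ y_out)).
  rewrite wy; have -> : w (s (s (s y))) = nx (w u0) by rewrite ws wy.
  have -> : w (s y) = nx (nx (w u0)) by rewrite -wy -!ws; rewrite !ws !nxK.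
  by rewrite nxK; lia.
case: (w_cases v u0) => [wv|wv|wv].
- by exists (s v); [exact: out_s | rewrite !ws nxK wv].
- by exists v; rewrite // !ws wv nxK.
exists (s (s v)); first exact/out_s/out_s.
by rewrite !ws nxK wv.
Qed.

(** The boolean records that every vertex has a predecessor; then the base point [u0] is arbitrary.
    Otherwise [u0] is the source, and the edge closing its hexagon is absent. *)
Lemma successor_classification (x : V) :
  (exists (s : V -> V) u0,
     [/\ forall v, v \in [:: u0; s u0; s (s u0)], s u0 != u0, s (s u0) != u0,
         s (s (s u0)) = u0 & forall u v, suc u v = (u != s (s u0)) && (s u == v)]) \/
  (exists (s : V -> V) u0 (b : bool),
     [/\ forall u, iter 6 s u = u, forall i u, 0 < i < 6 -> iter i s u != u
       & forall u v, suc u v = (b || (u != iter 5 s u0)) && (s u == v)]).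
Proof.
have [/existsP[u0 /forallP src]|no_src] :=
  boolP [exists u, [forall p, ~~ suc p u]]; last first.
  have no u : ~ source u.
    move=> su; case/negP: no_src; apply/existsP; exists u; exact/forallP.
  (* Without a source the clauses about closing a path are void, so [x] serves as both of its
     ends. *)
  have [s [_ sucE ws lam0]] : exists s : V -> V, [/\ injective s,
      forall u v, suc u v = (0 < lam u) && (s u == v),
      forall u, w (s u) = nx (w u)
    & forall u, lam u = 0 -> [/\ source x, u = x & s u = x]].
    by apply: closed_successor => [u|] /no.
  right; exists s, x, true.
  have [//|s6 sN] := hexagonal_successor sucE ws lam0; first by move=> /no.
  split=> // u v; rewrite sucE; have [/lam0[/no//]|//] := posnP (lam u).
have src_u u : source u -> u = u0 by move=> su; apply: source_unique.
have u0K t (s : V -> V) : lam t = 0 ->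
  (forall u, lam u = 0 -> [/\ source u0, u = t & s u = u0]) ->
  forall u, (0 < lam u) = (u != t).
  move=> z lam0 u; have [->|ut] := eqVneq u t; first by rewrite z.
  by rewrite lt0n; apply: contra ut => /eqP/lam0[_ ->].
case: (source_path src) => [[u1 [u2 [s1 s2 z e]]]|].
  have w2 : nx (w u2) = w u0 by rewrite (suc_w s2) (suc_w s1) nxK.
  have [s [s_inj sucE ws lam0]] := closed_successor src_u (fun _ => conj z w2).
  have [_ _ su2] := lam0 _ z.
  move: (s1) (s2); rewrite !sucE => /andP[_ /eqP su0] /andP[_ /eqP su1].
  left; exists s, u0; rewrite su0 su1 su2; split=> //.
  - by apply: (path3_successor s_inj sucE ws) => // u /lam0[].
  - by apply: contraTneq s1 => ->; apply: src.
  - by apply: contraTneq s2 => ->; apply: src.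
  by move=> u v; rewrite sucE (u0K u2 s).
case=> u1 [u2 [u3 [u4 [u5 [[s1 s2 s3 s4] [s5 z e]]]]]].
have w5 : nx (w u5) = w u0.
  by rewrite (suc_w s5) (suc_w s4) (suc_w s3) (suc_w s2) (suc_w s1) !nxK.
have [s [s_inj sucE ws lam0]] := closed_successor src_u (fun _ => conj z w5).
right; exists s, u0, false.
(* The alternating sum of the five relations along P_6 is the relation that the missing edge would
   satisfy. *)
have lab5 : lab u5 + lab u0 = nx (w u0).
  have := lab_sum s1; have := lab_sum s2; have := lab_sum s3.
  have := lab_sum s4; have := lab_sum s5.
  rewrite (suc_w s5) (suc_w s4) (suc_w s3) (suc_w s2) (suc_w s1) !nxK; lia.
have [//|s6 sN] := hexagonal_successor sucE ws lam0.
split=> // u v; rewrite sucE (u0K u5 s) //=; congr (_ && _).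
move: s1 s2 s3 s4 s5; rewrite !sucE.
by do 5![case/andP=> _ /eqP->].
Qed.

End SuccessorStructure.

(** * From three weights to the successor relation *)

(** One of the two cyclic orders is chosen. The last clause will identify the weight of an edge from
    those of its ends. *)
Lemma cyclic_order (a b c : nat) : uniq [:: a; b; c] -> exists nx : nat -> nat,
  [/\ {in [:: a; b; c], forall x, nx (nx (nx x)) = x},
      {in [:: a; b; c], forall x, nx x != x},
      {in [:: a; b; c] &, forall x y, [\/ x = y, x = nx y | y = nx x]}
    & {in [:: a; b; c] & &, forall x y z,
         uniq [:: x; y; z] -> y = nx x -> z = nx y}].
Proof.
rewrite /= !inE negb_or !andbT => /andP[/andP[ab ac] bc].
pose nx x := if x == a then b else if x == b then c else a.
have na : nx a = b by rewrite /nx eqxx.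
have nb : nx b = c by rewrite /nx eqxx eq_sym (negPf ab).
have nc : nx c = a by rewrite /nx 2!(eq_sym c) (negPf ac) (negPf bc).
exists nx; split.
- by move=> x /[!inE] /or3P[]/eqP->; rewrite ?na ?nb ?nc ?na ?nb ?nc ?na.
- by move=> x /[!inE] /or3P[]/eqP->; rewrite ?na ?nb ?nc // eq_sym.
- by move=> x y /[!inE] /or3P[]/eqP-> /or3P[]/eqP->; rewrite ?na ?nb ?nc;
    auto using Or31, Or32, Or33.
move=> x y z /[!inE] /or3P[]/eqP-> /or3P[]/eqP-> /or3P[]/eqP->;
  rewrite ?na ?nb ?nc /= ?inE; lia.
Qed.

Section ThreeWeights.
Variables (G : graph) (f : G + edge G -> nat).
Hypotheses (lta : local_total_antimagic f) (f3 : num_weights f = 3)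
  (no_isolated : forall x : G, exists y : G, adj x y).

Let lab u := f (inl u).
Let w := vweight f.

Lemma label_inj : injective f.
Proof. by have [[]] := lta. Qed.

Lemma label_gt0 x : 0 < f x.
Proof.
have [[_ fP] _ _ _] := lta.
by have /fP/andP[] : exists y, f y = f x by exists x.
Qed.

Lemma edge_label_gt0 u v : (0 < edge_label f u v) = adj u v.
Proof.
apply/idP/idP=> [|/adj_edge[e /edge_labelE->]]; last exact: label_gt0.
by apply: contraTT => /edge_label0->.
Qed.

Lemma edge_label_inj u v u' v' : adj u v ->
  edge_label f u v = edge_label f u' v' -> [set u; v] = [set u'; v'].
Proof.
move=> uv e; have uv' : adj u' v' by rewrite -edge_label_gt0 -e edge_label_gt0.
have [e1 E1] := adj_edge uv; have [e2 E2] := adj_edge uv'.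
move: e; rewrite (edge_labelE f E1) (edge_labelE f E2) => /label_inj[].
by rewrite -E1 -E2 => ->.
Qed.

Lemma label_neq_edge_label u v x : lab x != edge_label f u v.
Proof.
have [/adj_edge[e /edge_labelE->]|/edge_label0->] := boolP (adj u v).
  by apply/eqP=> /label_inj.
by rewrite -lt0n label_gt0.
Qed.

Lemma three_weights_structure (x0 : G) : exists suc : rel G,
  [/\ forall u v, adj u v = suc u v || suc v u
    & (exists (s : G -> G) u0,
         [/\ forall v, v \in [:: u0; s u0; s (s u0)], s u0 != u0,
             s (s u0) != u0, s (s (s u0)) = u0
           & forall u v, suc u v = (u != s (s u0)) && (s u == v)]) \/
      (exists (s : G -> G) u0 (b : bool),
         [/\ forall u, iter 6 s u = u, forall i u, 0 < i < 6 -> iter i s u != u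
           & forall u v, suc u v = (b || (u != iter 5 s u0)) && (s u == v)])].
Proof.
have [a [b [c [abc wP]]]] : exists a b c, uniq [:: a; b; c] /\
    forall x, weight f x \in [:: a; b; c].
  have := mem_undup [seq weight f x | x : G + edge G].
  have := undup_uniq [seq weight f x | x : G + edge G].
  move: f3; rewrite /num_weights.
  case: (undup _) => [|a [|b [|c [|//]]]] // _ abc wP; exists a, b, c; split=> // x.
  by rewrite wP; apply/mapP; exists x; rewrite ?mem_enum.
have [nx [nxK nxN nx_cases nx_third]] := cyclic_order abc.
have wS u : w u \in [:: a; b; c] := wP (inl u).
pose suc u v := adj u v && (w v == nx (w u)).
pose lam u := \sum_(v | suc u v) edge_label f u v.
have suc_adj u v : suc u v -> adj u v by case/andP.
have suc_w u v : suc u v -> w v = nx (w u) by case/andP=> _ /eqP.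
have suc_asym u v : suc u v -> suc v u -> False.
  move=> /suc_w vu /suc_w uv; have /eqP := nxN _ (wS u); apply.
  by rewrite -[RHS](nxK _ (wS u)) -vu -uv.
have adjE u v : adj u v = suc u v || suc v u.
  rewrite /suc (adj_sym v); have [uv|//] := boolP (adj u v).
  have [_ vv _ _] := lta; have := vv _ _ uv.
  by case: (nx_cases _ _ (wS u) (wS v)) => [//|->|->]; rewrite eqxx ?orbT.
have ew u v e : suc u v -> val e = [set u; v] -> eweight f e = nx (w v).
  move=> uv eE; apply: (nx_third (w u)) (suc_w _ _ uv) => //.
    exact: (wP (inr e)).
  have := weights_neq lta eE; rewrite /= !inE !negb_or -/w; lia.
(* Two edges leaving [u] are adjacent but have the same weight [nx (nx (w u))], so they coincide.
   Likewise two edges entering [v] below share the weight [nx (w v)]. *)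
have suc_fun u v v' : suc u v -> suc u v' -> v = v'.
  move=> uv uv'; have [e eE] := adj_edge (suc_adj _ _ uv).
  have [e' eE'] := adj_edge (suc_adj _ _ uv').
  have [ee|ee] := eqVneq e e'.
    move: eE; rewrite ee eE' => /set2_inj[[]//|[uv2 _]].
    by case: (suc_asym u u); rewrite {2}uv2.
  have [_ _ /(_ _ _ ee) h _] := lta; case: h.
    by apply/set0Pn; exists u; rewrite eE eE' !inE !eqxx.
  by rewrite (ew _ _ _ uv eE) (ew _ _ _ uv' eE') (suc_w _ _ uv) (suc_w _ _ uv').
have suc_inj u u' v : suc u v -> suc u' v -> u = u'.
  move=> uv uv'; have [e eE] := adj_edge (suc_adj _ _ uv).
  have [e' eE'] := adj_edge (suc_adj _ _ uv').
  have [ee|ee] := eqVneq e e'.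
    move: eE; rewrite ee eE' => /set2_inj[[]//|[_ uv2]].
    by case: (suc_asym v v); rewrite {1}uv2.
  have [_ _ /(_ _ _ ee) h _] := lta; case: h.
    by apply/set0Pn; exists v; rewrite eE eE' !inE !eqxx !orbT.
  by rewrite (ew _ _ _ uv eE) (ew _ _ _ uv' eE').
have lamE u v : suc u v -> lam u = edge_label f u v.
  move=> uv; rewrite /lam (big_pred1 v) // => x /=.
  by apply/idP/eqP=> [/suc_fun/(_ uv)|->].
(* An edge at [u] either leaves or enters [u], never both. *)
have wE u : w u = lam u + \sum_(p | suc p u) edge_label f u p.
  rewrite /w vweightE (bigID (suc u)) /=; congr (_ + _).
  rewrite [LHS](bigID (fun p => suc p u)) /= [X in _ + X]big1 ?addn0.
    apply: eq_bigl => p; apply: andb_idl => pu.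
    by apply/negP=> /suc_asym; apply.
  by move=> p pu; apply: edge_label0; rewrite adjE negb_or.
have lam_sum u v : suc u v -> lam u + lam v = w v.
  move=> uv; rewrite wE addnC (lamE _ _ uv) edge_label_sym (big_pred1 u) // => x /=.
  by apply/idP/eqP=> [/suc_inj/(_ uv)|->].
have lam_source u : (forall p, ~~ suc p u) -> lam u = w u.
  by move=> no; rewrite wE big_pred0 ?addn0 // => p; apply/negbTE.
have lam_gt0 u : reflect (exists v, suc u v) (0 < lam u).
  apply: (iffP idP) => [|[v uv]]; last by rewrite (lamE _ _ uv) edge_label_gt0 suc_adj.
  case: (pickP (suc u)) => [v uv _|no]; first by exists v.
  by rewrite /lam big_pred0.
have lam_inj u v : 0 < lam u -> lam u = lam v -> u = v.
  move=> u0 e; have v0 := u0; rewrite e in v0.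
  case/lam_gt0: u0 v0 => u' uu' /lam_gt0[v' vv'].
  move: e; rewrite (lamE _ _ uu') (lamE _ _ vv').
  case/(edge_label_inj (suc_adj _ _ uu'))/set2_inj=> -[// uE u'E].
  by case: (suc_asym u u'); rewrite // uE u'E.
have w_gt0 u : 0 < w u.
  have [v uv] := no_isolated u.
  by rewrite /w vweightE (bigD1 v) //= addn_gt0 edge_label_gt0 uv.
have lab_sum u v : suc u v -> lab u + lab v = nx (w v).
  move=> uv; have [e eE] := adj_edge (suc_adj _ _ uv).
  by rewrite -(ew _ _ _ uv eE) (eweightE f eE).
have lab_lam u v : lab u != lam v.
  have [/eqP|/lam_gt0[v' vv']] := posnP (lam v); last first.
    by rewrite (lamE _ _ vv') label_neq_edge_label.
  by move/eqP->; rewrite -lt0n label_gt0.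
exists suc; split=> //.
apply: (@successor_classification _ w lab lam suc nx) => //.
- by move=> u; apply: nxK.
- by move=> u; apply: nxN.
- by move=> u v; apply: nx_cases.
- by move=> u v /label_inj[].
- by move=> u; apply: label_gt0.
Qed.

Lemma three_weights_isomorphic (x0 : G) : isomorphic G (path_graph 3) \/
  exists n b, isomorphic G (hexagons n.+1 b).
Proof.
have [suc [adjE [[s [u0 [all3 s10 s20 s3 sucE]]]|]]] := three_weights_structure x0.
  left; apply: isomorphic_sym.
  have s21 : s (s u0) != s u0.
    by apply: contraNneq s10 => e; rewrite -[X in _ == X]s3 e e.
  have neqE := (negPf s10, negPf s20, negPf s21, eq_sym u0 (s u0),
    eq_sym u0 (s (s u0)), eq_sym (s u0) (s (s u0))).
  exists (fun i : 'I_3 => iter i s u0).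
    apply: inj_surj_bij => [i j e|v].
      apply: val_inj; move: e.
      by case: i j => [[|[|[|//]]] ?] [[|[|[|//]]] ?] //= /eqP; rewrite !neqE.
    have := all3 v; rewrite !inE => /or3P[]/eqP->.
    - by exists (inord 0); rewrite inordK.
    - by exists (inord 1); rewrite inordK.
    by exists (inord 2); rewrite inordK.
  move=> i j; rewrite adjE !sucE /= /P_adj.
  by case: i j => [[|[|[|//]]] ?] [[|[|[|//]]] ?] /=; rewrite ?s3 ?eqxx ?neqE ?andbF.
move=> [s [u0 [b [s6 sN sucE]]]]; right.
have [n [h [bij_h hs h0]]] := hexagon_coordinates u0 s6 sN.
exists n, b; apply: isomorphic_sym; exists h => // x y.
have h_inj := bij_inj bij_h.
(* Cycle 0 starts at [u0], so the possibly missing edge leaves its position 5. *)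
have h5 : h (ord0, ord_max) = iter 5 s u0.
  rewrite -h0 /= -!hs; congr h; congr (_, _); exact: val_inj.
rewrite adjE !sucE -h5 -!hs !(inj_eq h_inj) /= /hex_adj.
have edgeE z : hex_edge b z = b || (z != (ord0, ord_max)).
  rewrite /hex_edge; congr (b || _); case: z => c i /=.
  rewrite xpair_eqE negb_and -!val_eqE /= lt0n.
  by case: i => [[|[|[|[|[|[|//]]]]]] ?].
by rewrite !edgeE.
Qed.

End ThreeWeights.

Theorem theorem3p5 (G : graph)
  (hp : 3 <= gorder G) (hq : 2 <= gsize G)
  (no_isolated : forall x : G, exists y : G, adj x y)
  (no_K2 : forall x : G, ~ isomorphic (induced (component x)) (complete 2)) :
  chi_lt G 3 <->
  [\/ isomorphic G (path_graph 3),
      isomorphic G (path_graph 6),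
      exists2 m : nat, 1 <= m & isomorphic G (copies m (cycle_graph 6))
    | exists m : nat,
        isomorphic G (disjoint_union (copies m (cycle_graph 6)) (path_graph 6))].
Proof.
split=> [[[f lta f3] _]|[|P6|[m m0 C6]|[m CP6]]].
- have /card_gt0P[x0 _] : 0 < gorder G by apply: leq_trans hp.
  have [P3|[n [[] Gn]]] := three_weights_isomorphic lta f3 no_isolated x0.
  + by constructor 1.
  + by constructor 3; exists n.+1 => //; apply: isomorphic_trans Gn (hexagons_cycles _).
  (* For [n = 0] this is P_6 alone. *)
  by constructor 4; exists n; apply: isomorphic_trans Gn (hexagons_cycles_path _).
- exact: chi_lt_path3.
- apply: (@chi_lt_hexagons 1 false) => //.
  exact: isomorphic_trans P6 (isomorphic_sym hexagons_path).
- apply: (chi_lt_hexagons m0 (b := true)).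
  exact: isomorphic_trans C6 (isomorphic_sym (hexagons_cycles m)).
apply: (@chi_lt_hexagons m.+1 false) => //.
exact: isomorphic_trans CP6 (isomorphic_sym (hexagons_cycles_path m)).
Qed.
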